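(* Let $1\le p\le\infty$. For all seed functions $f,f'\in\mathcal{L}^p(I)$ and every base function $b\in\mathcal{L}^p(I)$, $$\|(f*_Tb)-(f'*_Tb)\|_p\le\frac{1}{1-\Lambda}\|f-f'\|_p,$$ and for all base functions $b,b'\in\mathcal{L}^p(I)$ and every seed function $f\in\mathcal{L}^p(I)$, $$\|(f*_Tb)-(f*_Tb')\|_p\le\frac{\Lambda}{1-\Lambda}\|b-b'\|_p.$$ For $0<p<1$ the same inequalities hold with $\|g-h\|_p$ replaced by $d_p(g,h)=\int_I|g-h|^p\,dx$ and $\Lambda$ replaced by $\Lambda^p$.
   Context: Let $N\ge 2$, $I=[x_0,x_N]\subset\mathbb{R}$ and $\Delta: x_0<x_1<\dots<x_N$ a partition of $I$. For $n=1,\dots,N$ let $L_n(x)=a_nx+b_n$ be the affine map with $L_n(x_0)=x_{n-1}$, $L_n(x_N)=x_n$; set $I_1=[x_0,x_1]$, $I_n=(x_{n-1},x_n]$ for $n\ge 2$. Let $\alpha=(\alpha_1,\dots,\alpha_N)\in(\mathcal{L}^\infty(I))^N$ with $\Lambda:=\operatorname{ess\,sup}\{|\alpha_n(x)|:x\in I,\ n=1,\dots,N\}<1$. For $0<p\le\infty$ and $f,b\in\mathcal{L}^p(I)$, the fractal convolution $f*_Tb$ is the unique fixed point in $\mathcal{L}^p(I)$ of the contraction $Tg(x):=f(x)+\alpha_n(L_n^{-1}(x))\,(g-b)(L_n^{-1}(x))$, $x\in I_n$, $n=1,\dots,N$; i.e. $(f*_Tb)(x)=f(x)+\alpha_n(L_n^{-1}(x))((f*_Tb)-b)(L_n^{-1}(x))$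 on $I_n$. The partition, the maps $L_n$ and $\alpha$ are fixed. *)

(* Defs.v *)
From HB Require Import structures.
From mathcomp Require Import all_boot all_order all_algebra.
From mathcomp Require Import all_classical all_reals all_analysis.
From mathcomp Require Import ess_sup_inf.
Set Implicit Arguments. Unset Strict Implicit. Unset Printing Implicit Defensive.
Import Order.TTheory GRing.Theory Num.Def Num.Theory.
Import numFieldNormedType.Exports.
Local Open Scope classical_set_scope.
Local Open Scope ring_scope.

Section FractalConvolution.
Context {R : realType}.
(* Partition x_0 < x_1 < ... < x_N of I = [x_0, x_N] (x : nat -> R,
   only x 0, ..., x N matter). *)
Variables (N : nat) (x : nat -> R).

Definition Iset : set R := [set` `[x 0%N, x N]].

Definition muI := mrestr (@lebesgue_measure R) (measurable_itv `[x 0%N, x N]).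

Definition Isub (n : nat) : set R :=
  if n == 1%N then [set` `[x 0%N, x 1%N]] else [set` `]x n.-1, x n]].

(* L_n(t) = a_n t + b_n with L_n(x_0) = x_{n-1}, L_n(x_N) = x_n. *)
Definition Lmap (n : nat) (t : R) : R :=
  x n.-1 + (t - x 0%N) * ((x n - x n.-1) / (x N - x 0%N)).

Definition Linv (n : nat) (y : R) : R :=
  x 0%N + (y - x n.-1) * ((x N - x 0%N) / (x n - x n.-1)).

Definition LambdaE (alpha : nat -> R -> R) : \bar R :=
  ess_sup muI (fun t => (\big[Num.max/0]_(1 <= n < N.+1) `|alpha n t|)%:E).

Definition inLp (p : \bar R) (f : R -> R) : Prop :=
  measurable_fun Iset f /\ (Lnorm muI p (EFin \o f) < +oo)%E.

(* T g = g almost everywhere on I, i.e. g is (a representative of) the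
   fixed point of T in L^p(I). *)
Definition fixpointT (alpha : nat -> R -> R) (f b g : R -> R) : Prop :=
  {ae muI, forall y, forall n, (1 <= n <= N)%N -> Isub n y ->
     g y = f y + alpha n (Linv n y) * (g (Linv n y) - b (Linv n y))}.

Definition is_fconv (alpha : nat -> R -> R) (p : \bar R) (f b g : R -> R) : Prop :=
  inLp p g /\ fixpointT alpha f b g.

Definition dp (p : R) (g h : R -> R) : \bar R :=
  (\int[muI]_y (`|g y - h y| `^ p)%:E)%E.

End FractalConvolution.

(* Main.v *)
(* Let phi : I -> I be L_n^-1 on each I_n. The slopes a_n of the maps L_n add up
   to 1, so phi preserves Lebesgue measure on I. The fixed-point equations give,
   for u = f * b - f' * b',
     |u| <= |f - f'| + Lambda (|u - (b - b')| o phi)   almost everywhere,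
   and composition with phi does not change the L^p norm (1 <= p <= oo) nor
   \int |.|^p (p < 1). Both functionals are subadditive, so that
     nrm u <= nrm (f - f') + k nrm (u - (b - b')),   k = Lambda or Lambda^p,
   and k < 1 lets one solve for nrm u, which is finite. *)
Require Import Defs.
From HB Require Import structures.
From mathcomp Require Import all_boot all_order all_algebra.
From mathcomp Require Import all_classical all_reals all_analysis.
From mathcomp Require Import ess_sup_inf measurable_realfun.
From mathcomp Require Import ring.
Set Implicit Arguments.
Unset Strict Implicit.
Import Order.TTheory GRing.Theory Num.Def Num.Theory.
Import numFieldNormedType.Exports.
Local Open Scope classical_set_scope.
Local Open Scope ring_scope.

(** * Monotonicity of integrals and norms under almost everywhere bounds *)

Section ae_monotone.
Local Open Scope ereal_scope.
Context d {T : measurableType d} {R : realType}.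
Variable mu : {measure set T -> \bar R}.

Import HBNNSimple.

(* Unlike ae_ge0_le_integral, no measurability is assumed: the integral of a
   nonnegative function is a supremum over simple functions below it, and a
   simple function can be set to 0 on a null set at no cost. *)
Lemma ae_le_integralT (F G : T -> \bar R) :
  (forall t, 0 <= F t) -> (forall t, 0 <= G t) ->
  {ae mu, forall t, F t <= G t} -> \int[mu]_t F t <= \int[mu]_t G t.
Proof.
move=> F0 G0 [N [mN N0 FGN]].
rewrite !ge0_integralTE//; apply: ge_ereal_sup => _ [h/= hF <-].
have mNC : measurable (~` N) by exact: measurableC.
apply: le_ereal_sup_tmp; exists (sintegral mu (proj_nnsfun h mNC)).
  exists (proj_nnsfun h mNC) => // t; rewrite -mrestrict /patch.
  case: ifPn => [/[!inE] tN|//]; rewrite (le_trans (hF t))//.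
  by apply: contrapT => FG; apply: tN; exact: FGN.
rewrite -!integralT_nnsfun le_eqVlt; apply/orP; left; apply/eqP.
apply: ae_eq_integral => //; [exact/measurable_EFinP..|].
exists N; split => // t ht; apply: contrapT => tN; apply: ht => _.
by rewrite -mrestrict patchE mem_set.
Qed.

Lemma ae_le_Lnorm (p : \bar R) (f g : T -> R) : 1 <= p ->
  {ae mu, forall t, (`|f t| <= `|g t|)%R} ->
  Lnorm mu p (EFin \o f) <= Lnorm mu p (EFin \o g).
Proof.
move=> p1 fg; rewrite unlock; case: p p1 => [r|_|//].
- rewrite lee_fin => r1.
  have nneg (h : T -> R) : \int[mu]_t `|(EFin \o h) t| `^ r \in `[0, +oo].
    rewrite in_itv/= leey andbT.
    by apply: integral_ge0 => t _; rewrite lee_fin powR_ge0.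
  apply: gt0_ler_poweR; rewrite ?nneg ?invr_ge0 ?(le_trans _ r1)//.
  apply: ae_le_integralT => [t|t|]; [exact: poweR_ge0..|].
  apply: filterS fg => t fgt /=.
  rewrite lee_fin ge0_ler_powR// ?nnegrE//.
  exact: le_trans r1.
- by case: ifPn => // _; apply: le_ess_sup; apply: filterS fg.
Qed.

Lemma ae_le_integral_powR (p : R) (f g : T -> R) : (0 <= p)%R ->
  {ae mu, forall t, (`|f t| <= `|g t|)%R} ->
  \int[mu]_t (`|f t| `^ p)%:E <= \int[mu]_t (`|g t| `^ p)%:E.
Proof.
move=> p0 fg; apply: ae_le_integralT => [t|t|].
- by rewrite lee_fin powR_ge0.
- by rewrite lee_fin powR_ge0.
by apply: filterS fg => t fgt; rewrite lee_fin ge0_ler_powR// nnegrE.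
Qed.

End ae_monotone.

(** Put s = a + b. For 0 < c <= s the ratio c / s lies in (0, 1], so its p-th power is at least
    itself and c^p >= s^p (c / s). The cases c = a and c = b add up to s^p. *)
Lemma powR_subadditive (R : realType) (p a b : R) :
  0 < p <= 1 -> 0 <= a -> 0 <= b -> (a + b) `^ p <= a `^ p + b `^ p.
Proof.
move=> /andP[p0 p1] a0 b0.
have [->|an0] := eqVneq a 0; first by rewrite add0r powR0 ?gt_eqF// add0r.
have [->|bn0] := eqVneq b 0; first by rewrite addr0 powR0 ?gt_eqF// addr0.
have {an0}a0 : 0 < a by rewrite lt_neqAle eq_sym an0.
have {bn0}b0 : 0 < b by rewrite lt_neqAle eq_sym bn0.
have s0 : 0 < a + b by exact: addr_gt0.
have aux c : 0 < c -> c <= a + b -> (a + b) `^ p * (c / (a + b)) <= c `^ p.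
  move=> c0 cs; have cE : c = (a + b) * (c / (a + b)).
    by rewrite mulrCA divff ?mulr1// gt_eqF.
  rewrite [in leRHS]cE powRM ?(ltW s0) ?divr_ge0 ?(ltW c0) ?(ltW s0)//.
  rewrite ler_wpM2l ?powR_ge0// ger1_powR// divr_gt0//=.
  by rewrite ler_pdivrMr// mul1r.
apply: le_trans (lerD (aux a a0 _) (aux b b0 _)); last 2 first.
- by rewrite lerDl ltW.
- by rewrite lerDr ltW.
by rewrite -mulrDr -mulrDl divff ?gt_eqF// mulr1.
Qed.

(** * Composition with a measure-preserving map *)

Section measure_preserving.
Local Open Scope ereal_scope.
Context d {T : measurableType d} {R : realType}.
Variables (mu : {measure set T -> \bar R}) (phi : T -> T).
Hypothesis mphi : measurable_fun [set: T] phi.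
Hypothesis muphi : forall A, measurable A -> mu (phi @^-1` A) = mu A.

Lemma ae_preserved (P : T -> Prop) :
  {ae mu, forall t, P t} -> {ae mu, forall t, P (phi t)}.
Proof.
move=> [N [mN N0 PN]]; exists (phi @^-1` N); split.
- by rewrite -[X in measurable X]setTI; exact: mphi.
- by rewrite muphi.
- by move=> t /= Pt; exact: PN.
Qed.

Lemma ge0_integral_preserved (F : T -> \bar R) :
  measurable_fun [set: T] F -> (forall t, 0 <= F t) ->
  \int[mu]_t F (phi t) = \int[mu]_t F t.
Proof.
move=> mF F0.
rewrite -[LHS](@ge0_integral_pushforward _ _ _ _ _ _ mphi mu setT F)//.
by apply: eq_measure_integral => A mA _; exact: muphi.
Qed.

(** For finite p this is the change of variables for the pushforward measure. For p = oo, the set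
    where |f| exceeds its essential supremum is null, and so is its preimage under [phi]. *)
Lemma Lnorm_preserved (p : \bar R) (f : T -> R) : 1 <= p ->
  measurable_fun [set: T] f ->
  Lnorm mu p (EFin \o (f \o phi)) <= Lnorm mu p (EFin \o f).
Proof.
move=> p1 mf; rewrite unlock; case: p p1 => [r r1|_|//].
- rewrite (@ge0_integral_preserved (fun t => `|(f t)%:E| `^ r))//.
  + apply: (measurableT_comp (measurable_poweR r)).
    by apply: measurableT_comp => //; exact/measurable_EFinP.
  + by move=> t; exact: poweR_ge0.
- case: ifPn => // _; apply/ess_supP.
  exact: (@ae_preserved (fun t => `|(f t)%:E| <= _)
            (ess_sup_ge mu (abse \o (EFin \o f)))).
Qed.

Lemma integral_powR_preserved (p : R) (f : T -> R) :
  measurable_fun [set: T] f ->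
  \int[mu]_t (`|f (phi t)| `^ p)%:E = \int[mu]_t (`|f t| `^ p)%:E.
Proof.
move=> mf; rewrite (@ge0_integral_preserved (fun t => (`|f t| `^ p)%:E))//.
apply/measurable_EFinP.
apply: (measurableT_comp (measurable_powR p)).
exact: measurableT_comp.
Qed.

End measure_preserving.

(** * The contraction estimate for an abstract functional *)

Section gauge.
Local Open Scope ereal_scope.
Context d {T : measurableType d} {R : realType}.
Variables (mu : {measure set T -> \bar R}) (phi : T -> T).

(* The properties shared by the L^p norm for p >= 1 (with k = c) and by the
   functional \int |f|^p for p < 1 (with k = c^p). *)
Record gauge (c k : R) (nrm : (T -> R) -> \bar R) : Prop := Gauge {
  gauge_ge0 : forall f, 0 <= nrm f;
  gauge_mono : forall f g, {ae mu, forall t, (`|f t| <= `|g t|)%R} ->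
    nrm f <= nrm g;
  gaugeD : forall f g : T -> R,
    measurable_fun [set: T] f -> measurable_fun [set: T] g ->
    nrm (f \+ g)%R <= nrm f + nrm g;
  gaugeZ : forall f : T -> R, measurable_fun [set: T] f ->
    nrm (fun t => c * f t)%R <= k%:E * nrm f;
  gauge_comp : forall f : T -> R, measurable_fun [set: T] f ->
    nrm (f \o phi) <= nrm f }.

Variables (c k : R) (nrm : (T -> R) -> \bar R).
Hypothesis gnrm : gauge c k nrm.
Hypotheses (mphi : measurable_fun [set: T] phi) (c0 : (0 <= c)%R).
Hypotheses (k0 : (0 <= k)%R) (k1 : (k < 1)%R).

(** Applying [nrm] to the pointwise bound gives nrm u <= nrm w + k nrm u. Finiteness of [nrm u] is
    what permits moving k nrm u to the left in the extended reals. *)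
Lemma gauge_contraction (u w : T -> R) :
  measurable_fun [set: T] u -> measurable_fun [set: T] w -> nrm u < +oo ->
  {ae mu, forall t, (`|u t| <= `|w t| + c * `|u (phi t)|)%R} ->
  nrm u <= ((1 - k)^-1)%:E * nrm w.
Proof.
move=> mfu mw uoo uw.
have nrm_norm f : nrm (normr \o f) <= nrm f.
  by apply: (gauge_mono gnrm); apply: aeW => t /=; rewrite normr_id.
have m_norm (f : T -> R) : measurable_fun [set: T] f ->
    measurable_fun [set: T] (normr \o f).
  by move=> mf; exact: measurableT_comp.
have mup : measurable_fun [set: T] (u \o phi) by exact: measurableT_comp.
have : nrm u <= nrm w + k%:E * nrm u.
  (* The majorant of |u| has to be a sum of measurable functions for [gaugeD], hence the absolute
     values inside it; [nrm_norm] removes them afterwards. *)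
  apply: (@le_trans _ _
      (nrm ((normr \o w) \+ (fun t => c * (normr \o (u \o phi)) t))%R)).
    apply: (gauge_mono gnrm); apply: filterS uw => t /le_trans; apply.
    exact: ler_norm.
  apply: (le_trans (gaugeD gnrm (m_norm _ mw) _)).
    by apply: measurable_funM => //; exact: m_norm.
  apply: leeD => //; apply: (le_trans (gaugeZ gnrm (m_norm _ mup))).
  rewrite lee_wpmul2l ?lee_fin//; apply: (le_trans (nrm_norm _)).
  exact: (gauge_comp gnrm).
have ufin : nrm u \is a fin_num by rewrite ge0_fin_numE// (gauge_ge0 gnrm).
rewrite lee_pdivlMl ?subr_gt0//.
rewrite -(fineK ufin) -!EFinM -leeBlDr// -EFinB => h.
by rewrite mulrBl mul1r.
Qed.

(** The previous estimate with [c * (w \o phi)] in place of [w]: scaling costs a factor [k], which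
    becomes the numerator, and composition with [phi] costs nothing. *)
Lemma gauge_contraction_comp (u w : T -> R) :
  measurable_fun [set: T] u -> measurable_fun [set: T] w -> nrm u < +oo ->
  {ae mu, forall t, (`|u t| <= c * (`|u (phi t)| + `|w (phi t)|))%R} ->
  nrm u <= (k / (1 - k))%:E * nrm w.
Proof.
move=> mfu mw uoo uw.
have mwp : measurable_fun [set: T] (w \o phi) by exact: measurableT_comp.
have := @gauge_contraction u (fun t => c * (w \o phi) t)%R mfu _ uoo.
move=> /(_ _ _)/le_trans; apply.
- exact: measurable_funM.
- apply: filterS uw => t /le_trans; apply.
  by rewrite normrM (ger0_norm c0) mulrDr addrC.
- have k1V : (0 <= (1 - k)^-1)%R by rewrite invr_ge0 subr_ge0 ltW.
  rewrite mulrC EFinM -muleA lee_wpmul2l ?lee_fin//.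
  apply: (le_trans (gaugeZ gnrm mwp)).
  by rewrite lee_wpmul2l ?lee_fin//; exact: (gauge_comp gnrm).
Qed.

End gauge.

(** * The L^p norm and the integral of |f|^p as gauges *)

Section gauge_instances.
Local Open Scope ereal_scope.
Context d {T : measurableType d} {R : realType}.
Variables (mu : {measure set T -> \bar R}) (phi : T -> T).
Hypothesis mphi : measurable_fun [set: T] phi.
Hypothesis muphi : forall A, measurable A -> mu (phi @^-1` A) = mu A.

Lemma ge0_integral_powRZ (p c : R) (f : T -> R) : (0 <= c)%R ->
  measurable_fun [set: T] f ->
  \int[mu]_t (`|c * f t| `^ p)%:E = (c `^ p)%:E * \int[mu]_t (`|f t| `^ p)%:E.
Proof.
move=> c0 mf; rewrite -ge0_integralZl_EFin ?powR_ge0//.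
- apply: eq_integral => t _.
  by rewrite -EFinM normrM (ger0_norm c0) powRM.
- apply/measurable_EFinP; apply: (measurableT_comp (measurable_powR p)).
  exact: measurableT_comp.
Qed.

Lemma gauge_Lnorm (c : R) (p : \bar R) : (0 <= c)%R -> 1 <= p ->
  gauge mu phi c c (fun f => Lnorm mu p (EFin \o f)).
Proof.
move=> c0 p1; split.
- by move=> f; exact: Lnorm_ge0.
- by move=> f g; exact: ae_le_Lnorm.
- by move=> f g mf mg; exact: eminkowski.
- move=> f mf; rewrite unlock; case: p p1 => [r r1|_|//].
  + have r0 : (0 < r)%R by rewrite lee_fin in r1; exact: lt_le_trans r1.
    rewrite (@ge0_integral_powRZ r c f c0 mf).
    rewrite poweRM ?lee_fin ?powR_ge0//.
      by rewrite poweR_EFin -powRrM divff ?gt_eqF// powRr1.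
    by apply: integral_ge0 => t _; rewrite lee_fin powR_ge0.
  (* For p = oo the norm is the essential supremum on a space of positive measure, and 0 by
     convention on a null space. *)
  + case: ifPn => [mu0|]; last by rewrite mule0.
    rewrite -ess_supZl//; apply: le_ess_sup; apply: aeW => t /=.
    by rewrite -EFinM normrM (ger0_norm c0).
- by move=> f; exact: Lnorm_preserved.
Qed.

Lemma gauge_integral_powR (c p : R) : (0 <= c)%R -> (0 < p <= 1)%R ->
  gauge mu phi c (c `^ p) (fun f => \int[mu]_t (`|f t| `^ p)%:E).
Proof.
move=> c0 /[dup] p01 /andP[p0 p1]; split.
- by move=> f; apply: integral_ge0 => t _; rewrite lee_fin powR_ge0.
- by move=> f g; apply: ae_le_integral_powR; exact: ltW.
- move=> f g mf mg.
  have mpow (h : T -> R) : measurable_fun [set: T] h ->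
      measurable_fun [set: T] (fun t => (`|h t| `^ p)%:E).
    move=> mh; apply/measurable_EFinP.
    apply: (measurableT_comp (measurable_powR p)).
    exact: measurableT_comp.
  rewrite -ge0_integralD//; [|exact: mpow..].
  apply: ae_le_integralT => [t|t|].
  + by rewrite lee_fin powR_ge0.
  + by rewrite adde_ge0// lee_fin powR_ge0.
  apply: aeW => t; rewrite -EFinD lee_fin.
  apply: le_trans (powR_subadditive p01 (normr_ge0 _) (normr_ge0 _)).
  by rewrite ge0_ler_powR ?nnegrE ?addr_ge0// ?ler_normD// ltW.
- by move=> f mf; rewrite ge0_integral_powRZ.
- by move=> f mf; rewrite -(integral_powR_preserved mphi muphi p mf).
Qed.

End gauge_instances.

(** * Lebesgue measure under an affine change of variable *)

Section affine.
Local Open Scope ereal_scope.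
Context {R : realType}.
Local Notation mu := (@lebesgue_measure R).

(** By uniqueness of Lebesgue measure: c times its pushforward under t -> c t + e gives every
    interval ]a, b] its length. *)
Lemma lebesgue_measure_affine (c e : R) (A : set (measurableTypeR R)) :
  (0 < c)%R -> measurable A ->
  mu ((fun t => c * t + e)%R @^-1` A) = (c^-1)%:E * mu A.
Proof.
move=> c0 mA.
pose f : measurableTypeR R -> measurableTypeR R := fun t => (c * t + e)%R.
have mf : measurable_fun [set: measurableTypeR R] f.
  by apply: measurable_funD => //; exact: measurable_funM.
(* [pose] abstracts the measurability proof needed by [pushforward]. *)
pose nu : {measure set (measurableTypeR R) -> \bar R} :=
  mscale (NngNum (ltW c0)) (pushforward mu f).
rewrite (@lebesgue_measure_unique R (nu mf) _ A mA).
  by rewrite /nu/= /mscale/= muleA -EFinM mulVf ?gt_eqF// mul1e.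
move=> _ [[a b]] _ <-.
rewrite /nu/= /mscale/= /pushforward.
rewrite (_ : f @^-1` _ = [set` `](a - e) / c, (b - e) / c]%R]); last first.
  apply/seteqP; split => t /=; rewrite !in_itv/= /f ltr_pdivrMr// ler_pdivlMr//;
  by rewrite ltrBlDr lerBrDr (mulrC t).
rewrite !lebesgue_measure_itv/= !lte_fin ltr_pM2r ?invr_gt0// ltrD2r.
case: ifPn => _; last by rewrite mule0.
by rewrite -EFinD -EFinM -mulrBl mulrCA divff ?gt_eqF// mulr1 opprB addrA subrK.
Qed.

End affine.

(** * The folding map of the partition preserves Lebesgue measure on I *)

Section folding.
Context {R : realType}.
Variables (N : nat) (x : nat -> R).
Hypothesis N0 : (0 < N)%N.
Hypothesis xS : forall i, (i < N)%N -> x i < x i.+1.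
Local Notation leb := (@lebesgue_measure R).

Lemma partition_lt i j : (i < j <= N)%N -> x i < x j.
Proof.
elim: j => // j IH; rewrite ltnS => /andP[ij jN].
move: ij; rewrite leq_eqVlt => /predU1P[->|ij]; first exact: xS.
by apply: lt_trans (xS jN); apply: IH; rewrite ij ltnW.
Qed.

Lemma partition_le i j : (i <= j <= N)%N -> x i <= x j.
Proof.
move=> /andP[]; rewrite leq_eqVlt => /predU1P[->//|ij jN].
by apply/ltW/partition_lt; rewrite ij.
Qed.

(* On I_n with n <= k this is L_n^-1, whence foldI N is a self-map of I. *)
Fixpoint foldI (k : nat) (y : R) : R :=
  if k is k'.+1 then if y <= x k' then foldI k' y else Linv N x k y
  else Linv N x 1 y.

Lemma measurable_Linv n : measurable_fun [set: R] (Linv N x n).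
Proof.
apply: measurable_funD => //; apply: measurable_funM => //.
exact: measurable_funB.
Qed.

Lemma measurable_foldI k : measurable_fun [set: R] (foldI k).
Proof.
elim: k => [|k IH] /=; first exact: measurable_Linv.
apply: measurable_fun_ifT => //; last exact: measurable_Linv.
exact: measurable_fun_ler.
Qed.

(** [foldI] compares y with the breakpoints from the top down. A point of I_n passes every test y <=
    x_j with j >= n and, when n >= 2, fails the one at n - 1. *)
Lemma foldIE k n y : (0 < n <= k)%N -> (k <= N)%N -> Isub x n y ->
  foldI k y = Linv N x n y.
Proof.
elim: k => [|k IH] /andP[n0]; first by rewrite leqNgt n0.
move=> nk kN /[dup] ny; rewrite /Isub /=.
move: nk; rewrite leq_eqVlt => /predU1P[->|nk]; last first.
  have -> : y <= x k.
    apply: (@le_trans _ _ (x n)).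
      by move: ny; rewrite /Isub; case: ifPn => [/eqP ->|_] /=;
        rewrite in_itv/= => /andP[].
    by apply: partition_le; rewrite -ltnS nk ltnW.
  by move=> _; apply: IH => //; [rewrite n0|exact: ltnW].
(* The cell I_1 contains x_0, which passes the test y <= x_0; this is harmless because both branches
   of [foldI 1] are [Linv N x 1]. *)
case: ifPn => [/eqP[->]|_]; first by rewrite if_same.
by rewrite /= in_itv/= => /andP[]; rewrite ltNge => /negbTE ->.
Qed.

Lemma Isub_cover y : Iset N x y -> exists2 n, (1 <= n <= N)%N & Isub x n y.
Proof.
rewrite /Iset/= in_itv/= => /andP[y0].
suff H k : (0 < k <= N)%N -> y <= x k ->
    exists2 n, (1 <= n <= k)%N & Isub x n y.
  by apply: H; rewrite N0 leqnn.
elim: k => // k IH /= kN yk.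
have [yxk|xky] := leP y (x k).
  (* For k = 0 the point y is x_0, which belongs to I_1 because that cell is closed on the left. *)
  have [k0|k0] := posnP k.
    by exists 1%N => //; rewrite /Isub/= in_itv/= y0 -k0.
  have [|n /andP[n1 nk] ny] := IH _ yxk; first by rewrite k0 ltnW.
  by exists n => //; rewrite n1 ltnW.
exists k.+1; first by rewrite leqnn.
rewrite /Isub; case: ifPn => [/eqP[k0]|_] /=; rewrite in_itv/= ?xky//.
by rewrite y0 -k0.
Qed.

Local Open Scope ereal_scope.

Let xN0 : (0 < x N - x 0%N)%R.
Proof. by rewrite subr_gt0; apply: partition_lt; rewrite N0 leqnn. Qed.

(** The factor is the slope of L_{n+1}, the inverse of the slope of the affine map
    [Linv N x n.+1]. *)
Lemma lebesgue_measure_Linv n (A : set R) : (n < N)%N -> measurable A ->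
  leb (Linv N x n.+1 @^-1` A) = ((x n.+1 - x n) / (x N - x 0%N))%:E * leb A.
Proof.
move=> nN mA; have xn : (0 < x n.+1 - x n)%R by rewrite subr_gt0 xS.
rewrite -[in RHS]invf_div.
rewrite -(@lebesgue_measure_affine _ _
  (x 0%N - x n * ((x N - x 0%N) / (x n.+1 - x n)))%R)//.
  congr (leb (_ @^-1` A)); apply/funext => t; rewrite /Linv/=.
  by rewrite (mulrBl _ t) addrCA (mulrC t).
exact: divr_gt0.
Qed.

Lemma Linv_itv n y : (n < N)%N ->
  (x 0%N < Linv N x n.+1 y <= x N)%R = (x n < y <= x n.+1)%R.
Proof.
move=> nN; have xn : (0 < x n.+1 - x n)%R by rewrite subr_gt0 xS.
rewrite /Linv/= ltrDl pmulr_lgt0 ?divr_gt0// subr_gt0; congr (_ && _).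
rewrite -lerBrDl mulrCA -[leRHS]mulr1 ler_pM2l// ler_pdivrMr// mul1r.
by rewrite lerBlDr subrK.
Qed.

(** Induction on k: the cell ]x_k, x_{k+1}] is mapped by L_{k+1}^-1 onto ]x_0, x_N] and contributes
    the slope of L_{k+1} times the measure of A there. The slopes telescope. Half-open intervals
    keep the pieces disjoint. *)
Lemma lebesgue_measure_foldI k (A : set R) : (k <= N)%N -> measurable A ->
  leb (foldI k @^-1` A `&` `]x 0%N, x k]) =
  ((x k - x 0%N) / (x N - x 0%N))%:E * leb (A `&` `]x 0%N, x N]).
Proof.
move=> + mA; elim: k => [_|k IH kN].
  by rewrite subrr mul0r mul0e set_itvoc0 setI0 measure0.
have mAI : measurable (A `&` `]x 0%N, x N]) by exact: measurableI.
have mpre (f : R -> R) (B : set R) : measurable_fun [set: R] f ->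
    measurable B -> measurable (f @^-1` B).
  by move=> mf mB; rewrite -[X in measurable X]setTI; exact: mf.
have -> : foldI k.+1 @^-1` A `&` `]x 0%N, x k.+1] =
    (foldI k @^-1` A `&` `]x 0%N, x k]) `|`
    (Linv N x k.+1 @^-1` (A `&` `]x 0%N, x N])).
  apply/seteqP; split => y /=; rewrite !in_itv/= Linv_itv//.
    case: ifPn => [yk [Ay /andP[-> _]]|]; first by left.
    by rewrite -ltNge => ky [Ay /andP[_ yk]]; right; rewrite ky yk.
  move=> [[Ay /andP[y0 yk]]|[Ay /andP[ky yk]]].
    by rewrite yk y0 (le_trans yk)// ltW// xS.
  rewrite leNgt ky yk/= (le_lt_trans _ ky)//.
  by apply: partition_le; rewrite leq0n ltnW.
set A1 := _ `&` _; set A2 := Linv N x k.+1 @^-1` _.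
have -> : leb (A1 `|` A2) = leb A1 + leb A2.
  apply: measureU.
  - by apply: measurableI => //; apply: mpre => //; exact: measurable_foldI.
  - by apply: mpre => //; exact: measurable_Linv.
  - apply/seteqP; split => // y; rewrite /A1 /A2/= !in_itv/= Linv_itv//.
    by move=> [[_ /andP[_ yk]] [_ /andP[+ _]]]; rewrite ltNge yk.
rewrite IH 1?ltnW// lebesgue_measure_Linv// -ge0_muleDl ?lee_fin.
- by rewrite -EFinD -mulrDl (addrC (x k - _)%R) addrA subrK.
- by rewrite divr_ge0 ?(ltW xN0)// subr_ge0 partition_le// leq0n ltnW.
- by rewrite divr_ge0 ?(ltW xN0)// subr_ge0 ltW// xS.
Qed.

(** Dropping the null point x_0 turns I into an interval tiled exactly by the half-open cells. *)
Lemma muI_oc (A : set R) : measurable A ->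
  muI N x A = leb (A `&` `]x 0%N, x N]).
Proof.
move=> mA; rewrite /muI /mrestr.
have <- : A `&` `]x 0%N, x N] `|` A `&` [set x 0%N] = A `&` `[x 0%N, x N].
  by rewrite -setIUr setUC setU1itv// bnd_simp -subr_ge0 ltW.
have mA0 : measurable (A `&` [set x 0%N]) by exact: measurableI.
apply: measureU0 => //; first exact: measurableI.
by apply: (@subset_measure0 _ _ _ leb _ [set x 0%N]) => //;
  exact: lebesgue_measure_set1.
Qed.

Lemma muI_foldI (A : set R) : measurable A ->
  muI N x (foldI N @^-1` A) = muI N x A.
Proof.
move=> mA; rewrite !muI_oc//; last first.
  by rewrite -[X in measurable X]setTI; exact: measurable_foldI.
by rewrite lebesgue_measure_foldI// divff ?mul1e// gt_eqF.
Qed.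

(** On a null space an essential supremum would be -oo; positivity makes [LambdaE] nonnegative. *)
Lemma muI_gt0 : 0 < muI N x setT.
Proof.
rewrite muI_oc// setTI lebesgue_measure_itv/= lte_fin -subr_gt0 xN0.
by rewrite -EFinB lte_fin.
Qed.

Lemma ae_muI (P : R -> Prop) : (forall y, Iset N x y -> P y) ->
  {ae muI N x, forall y, P y}.
Proof.
move=> IP; exists (~` Iset N x); split.
- by apply: measurableC; exact: measurable_itv.
- by rewrite /muI /mrestr setICl measure0.
- by move=> y /= Py Iy; apply: Py; exact: IP.
Qed.

End folding.

(** * Lipschitz estimates for fixed points of T *)

Section fractal_convolution.
Local Open Scope ereal_scope.
Context {R : realType}.
Variables (N : nat) (x : nat -> R) (alpha : nat -> R -> R).
Hypothesis N0 : (0 < N)%N.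
Hypothesis xS : forall i, (i < N)%N -> (x i < x i.+1)%R.
Hypothesis Lambda1 : LambdaE N x alpha < 1%:E.
Local Notation I := (Iset N x).
Local Notation mu := (muI N x).
Local Notation phi := (foldI N x N).
Let Lam := fine (LambdaE N x alpha).

Let LambdaE_ge0 : 0 <= LambdaE N x alpha.
Proof.
apply: ess_sup_ger; first exact: muI_gt0.
by move=> t; rewrite lee_fin bigmax_ge_id.
Qed.

(** The essential supremum lies in [0, 1), so [fine], which sends infinite values to 0, loses
    nothing. *)
Let LamE : LambdaE N x alpha = Lam%:E.
Proof. by rewrite fineK// ge0_fin_numE// (lt_trans Lambda1)// ltry. Qed.

Lemma Lambda_ge0 : (0 <= Lam)%R.
Proof. by rewrite -lee_fin -LamE. Qed.

Lemma Lambda_lt1 : (Lam < 1)%R.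
Proof. by rewrite -lte_fin -LamE. Qed.

(** [LambdaE] is taken of the maximum over n, so one null set serves all the [alpha n]. *)
Lemma ae_le_Lambda :
  {ae mu, forall t n, (1 <= n <= N)%N -> (`|alpha n t| <= Lam)%R}.
Proof.
have := ess_sup_ge mu
  (fun t => (\big[Num.max/0%R]_(1 <= n < N.+1) `|alpha n t|)%:E).
apply: filterS => t; rewrite -/(LambdaE N x alpha) LamE lee_fin => tL n nN.
apply: le_trans tL.
apply: (@le_bigmax_seq _ _ _ _ 0%R n xpredT (fun n => `|alpha n t|%R)) => //.
by rewrite mem_index_iota ltnS.
Qed.

Let mphi : measurable_fun [set: measurableTypeR R]
  (phi : measurableTypeR R -> measurableTypeR R).
Proof. exact: measurable_foldI. Qed.

#[local] Instance ae_muI_filter : Filter (almost_everywhere mu).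
Proof. exact: ae_filter_ringOfSetsType. Qed.

(** For y in I_n both equations have the coefficient [alpha n (phi y)], since [phi y] is
    [Linv N x n y], so they can be subtracted. Its bound by [Lam] and the membership of [phi y] in I
    are almost everywhere facts, transported along [phi] by [ae_preserved]. *)
Lemma fixpointT_sub (f f' b b' g g' : R -> R) :
  fixpointT N x alpha f b g -> fixpointT N x alpha f' b' g' ->
  {ae mu, forall y, [/\ I y, I (phi y) & exists2 a, (`|a| <= Lam)%R &
    g y - g' y = f y - f' y +
      a * (g (phi y) - g' (phi y) - (b (phi y) - b' (phi y)))]%R}.
Proof.
move=> gT g'T.
have Iae : {ae mu, forall y, I y} by exact: ae_muI.
have Iphi := ae_preserved mphi (muI_foldI N0 xS) Iae.
have alphaphi := ae_preserved mphi (muI_foldI N0 xS) ae_le_Lambda.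
near=> y.
have Iy : I y by near: y.
have Ipy : I (phi y) by near: y.
split => //; have [n nN ny] := Isub_cover N0 Iy.
exists (alpha n (phi y)); first by move: n nN {ny}; near: y.
have -> : g y = (f y + alpha n (Linv N x n y) *
    (g (Linv N x n y) - b (Linv N x n y)))%R by move: n nN ny; near: y.
have -> : g' y = (f' y + alpha n (Linv N x n y) *
    (g' (Linv N x n y) - b' (Linv N x n y)))%R by move: n nN ny; near: y.
rewrite -(foldIE xS nN (leqnn N) ny).
ring.
Unshelve. all: by end_near. Qed.

Variables (k : R) (nrm : (R -> R) -> \bar R).
Hypothesis gnrm : gauge mu phi Lam k nrm.
Hypotheses (k0 : (0 <= k)%R) (k1 : (k < 1)%R).

(** The data are measurable on I only, while the gauge laws ask for measurability on the whole line.
    Truncation to I bridges the two, the complement of I being null for [mu]. *)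
Lemma gauge_restrict (h : R -> R) : nrm (h \_ I) = nrm h.
Proof.
by apply/eqP; rewrite eq_le; apply/andP; split; apply: (gauge_mono gnrm);
  apply: ae_muI => y Iy; rewrite patchE mem_set.
Qed.

Let measurable_restrictI (h : R -> R) :
  measurable_fun I h -> measurable_fun [set: R] (h \_ I).
Proof.
by move=> mh; apply/(measurable_restrictT _ _).1 => //; exact: measurable_itv.
Qed.

Let gauge_sub_lty (g g' : R -> R) : measurable_fun I g -> measurable_fun I g' ->
  nrm g < +oo -> nrm g' < +oo -> nrm (g \- g')%R < +oo.
Proof.
move=> mg mg' goo g'oo.
have mg'N : measurable_fun [set: R] (\- (g' \_ I))%R.
  by apply: measurableT_comp => //; exact: measurable_restrictI.
apply: (@le_lt_trans _ _ (nrm ((g \_ I) \+ (\- (g' \_ I)))%R)).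
  apply: (gauge_mono gnrm); apply: ae_muI => y Iy.
  by rewrite /= /patch mem_set.
apply: (le_lt_trans (gaugeD gnrm (measurable_restrictI mg) mg'N)).
rewrite lte_add_pinfty ?gauge_restrict//; apply: le_lt_trans g'oo.
rewrite -(gauge_restrict g').
by apply: (gauge_mono gnrm); apply: aeW => y; rewrite normrN.
Qed.

Lemma fconv_lipschitz_seed (f f' b g g' : R -> R) :
  measurable_fun I f -> measurable_fun I f' ->
  measurable_fun I g -> measurable_fun I g' -> nrm g < +oo -> nrm g' < +oo ->
  fixpointT N x alpha f b g -> fixpointT N x alpha f' b g' ->
  nrm (g \- g')%R <= ((1 - k)^-1)%:E * nrm (f \- f')%R.
Proof.
move=> mf mf' mg mg' goo g'oo gT g'T.
rewrite -(gauge_restrict (g \- g')%R) -(gauge_restrict (f \- f')%R).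
apply: (gauge_contraction gnrm mphi k0 k1).
- by apply: measurable_restrictI; exact: measurable_funB.
- by apply: measurable_restrictI; exact: measurable_funB.
- by rewrite gauge_restrict; exact: gauge_sub_lty.
apply: filterS (fixpointT_sub gT g'T) => y [Iy Ipy [a aL gE]].
(* The two base terms cancel, leaving f - f' plus a multiple of u o phi, where u = g - g'. *)
rewrite !patchE !mem_set//= gE subrr subr0 (le_trans (ler_normD _ _))//.
by rewrite lerD2l normrM ler_wpM2r.
Qed.

Lemma fconv_lipschitz_base (f b b' g g' : R -> R) :
  measurable_fun I b -> measurable_fun I b' ->
  measurable_fun I g -> measurable_fun I g' -> nrm g < +oo -> nrm g' < +oo ->
  fixpointT N x alpha f b g -> fixpointT N x alpha f b' g' ->
  nrm (g \- g')%R <= (k / (1 - k))%:E * nrm (b \- b')%R.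
Proof.
move=> mb mb' mg mg' goo g'oo gT g'T.
rewrite -(gauge_restrict (g \- g')%R) -(gauge_restrict (b \- b')%R).
apply: (gauge_contraction_comp gnrm mphi Lambda_ge0 k0 k1).
- by apply: measurable_restrictI; exact: measurable_funB.
- by apply: measurable_restrictI; exact: measurable_funB.
- by rewrite gauge_restrict; exact: gauge_sub_lty.
apply: filterS (fixpointT_sub gT g'T) => y [Iy Ipy [a aL gE]].
(* The two seed terms cancel, so the whole right-hand side carries the coefficient [a], including
   the term b - b'. *)
rewrite !patchE !mem_set//= gE subrr add0r normrM.
by rewrite ler_pM// ler_normB.
Qed.

End fractal_convolution.

(** [inLp] bounds the [Lnorm], whereas the gauge used for p < 1 is the integral itself, the p-th
    power of that [Lnorm]. *)
Lemma integral_powR_lty d (T : measurableType d) (R : realType)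
  (mu : {measure set T -> \bar R}) (p : R) (f : T -> R) : 0 < p ->
  (Lnorm mu p%:E (EFin \o f) < +oo -> \int[mu]_t (`|f t| `^ p)%:E < +oo)%E.
Proof.
move=> p0 foo.
rewrite [ltLHS](_ : _ = (Lnorm mu p%:E (EFin \o f) `^ p)%E) ?poweR_lty//.
by rewrite poweR_Lnorm// gt_eqF.
Qed.

Unset Implicit Arguments.

Theorem theorem3p4 (R : realType) (N : nat) (x : nat -> R) (alpha : nat -> R -> R) :
  (2 <= N)%N ->
  (forall i, (i < N)%N -> x i < x i.+1) ->
  (forall n, (1 <= n <= N)%N -> measurable_fun (Iset N x) (alpha n)) ->
  (LambdaE N x alpha < 1%:E)%E ->
  let Lam := fine (LambdaE N x alpha) in
  (forall p : \bar R, (1%:E <= p)%E ->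
     (forall f f' b g g' : R -> R,
        inLp N x p f -> inLp N x p f' -> inLp N x p b ->
        is_fconv N x alpha p f b g -> is_fconv N x alpha p f' b g' ->
        (Lnorm (muI N x) p (EFin \o (g \- g')%R)
          <= ((1 - Lam)^-1)%:E * Lnorm (muI N x) p (EFin \o (f \- f')%R))%E) /\
     (forall f b b' g g' : R -> R,
        inLp N x p f -> inLp N x p b -> inLp N x p b' ->
        is_fconv N x alpha p f b g -> is_fconv N x alpha p f b' g' ->
        (Lnorm (muI N x) p (EFin \o (g \- g')%R)
          <= (Lam / (1 - Lam))%:E * Lnorm (muI N x) p (EFin \o (b \- b')%R))%E)) /\
  (forall p : R, 0 < p < 1 ->
     (forall f f' b g g' : R -> R,
        inLp N x p%:E f -> inLp N x p%:E f' -> inLp N x p%:E b ->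
        is_fconv N x alpha p%:E f b g -> is_fconv N x alpha p%:E f' b g' ->
        (dp N x p g g' <= ((1 - Lam `^ p)^-1)%:E * dp N x p f f')%E) /\
     (forall f b b' g g' : R -> R,
        inLp N x p%:E f -> inLp N x p%:E b -> inLp N x p%:E b' ->
        is_fconv N x alpha p%:E f b g -> is_fconv N x alpha p%:E f b' g' ->
        (dp N x p g g' <= (Lam `^ p / (1 - Lam `^ p))%:E * dp N x p b b')%E)).
Proof.
move=> N2 xS _ Lambda1 Lam.
have N0 : (0 < N)%N by exact: ltnW.
have L0 : 0 <= Lam := Lambda_ge0 N0 xS Lambda1.
have L1 : Lam < 1 := Lambda_lt1 N0 xS Lambda1.
have mphi : measurable_fun [set: measurableTypeR R]
    (foldI N x N : measurableTypeR R -> measurableTypeR R).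
  exact: measurable_foldI.
have muphi := muI_foldI N0 xS.
split=> p.
- move=> p1; have G := gauge_Lnorm mphi muphi L0 p1.
  split=> [f f' b g g' [mf _] [mf' _] _|f b b' g g' _ [mb _] [mb' _]]
      [[mg goo] gT] [[mg' g'oo] g'T].
  + exact: (fconv_lipschitz_seed N0 xS Lambda1 G L0 L1
             mf mf' mg mg' goo g'oo gT g'T).
  + exact: (fconv_lipschitz_base N0 xS Lambda1 G L0 L1
             mb mb' mg mg' goo g'oo gT g'T).
- move=> /andP[p0 p1]; have p01 : 0 < p <= 1 by rewrite p0 ltW.
  have G := gauge_integral_powR mphi muphi L0 p01.
  have K0 : 0 <= Lam `^ p by exact: powR_ge0.
  have K1 : Lam `^ p < 1 
    by have := @gt0_ltr_powR _ p p0 Lam 1; rewrite !nnegrE powR1; apply.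
  split=> [f f' b g g' [mf _] [mf' _] _|f b b' g g' _ [mb _] [mb' _]]
      [[mg /(integral_powR_lty p0) goo] gT]
      [[mg' /(integral_powR_lty p0) g'oo] g'T].
  (* [dp N x p g g'] unfolds to the gauge of [g \- g']. *)
  + exact: (fconv_lipschitz_seed N0 xS Lambda1 G K0 K1
             mf mf' mg mg' goo g'oo gT g'T).
  + exact: (fconv_lipschitz_base N0 xS Lambda1 G K0 K1
             mb mb' mg mg' goo g'oo gT g'T).
Qed.
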